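(* Let $\mathfrak q$ be a $\theta$-stable parabolic subalgebra attached to the ordered sequence $\{(p_1,q_1),\dots,(p_r,q_r)\}$ of pairs of non-negative integers, none equal to $(0,0)$. Let $S=\coprod_{k=1}^r S_k$ be the $\mathfrak q$-consistent partition into skew columns (of the Young diagram $S$ underlying the signed tableau $S_\pm$ attached to $\mathfrak q$). Then for every $1\leqslant i\leqslant r-1$ the overlap of the adjacent skew columns $S_i$ and $S_{i+1}$ is $$\operatorname{overlap}(S_i,S_{i+1})=\min\{p_i,q_{i+1}\}+\min\{p_{i+1},q_i\}.$$
   Context: Parabolic attached to a sequence. Given an ordered sequence $\{(p_1,q_1),\dots,(p_r,q_r)\}$ of pairs of non-negative integers, none $(0,0)$, put $p=\sum p_i$, $q=\sum q_i$, $n_i=p_i+q_i$. Let $I_{p,q}$ be the diagonal matrix whose diagonal consists of $p_1$ pluses, then $q_1$ minuses, then $p_2$ pluses, then $q_2$ minuses, and so on; $U(p,q)$ preserves the Hermitian form $I_{p,q}$ and $\theta$ is the Cartan involution (inverse conjugate transpose). The $\theta$-stable parabolic $\mathfrak q=\mathfrak l\oplus\mathfrak u\subset\mathfrak{gl}(p+q,\mathbb C)$ attached to the sequence has $\mathfrak l=\mathfrak{gl}(n_1,\mathbb C)\oplus\cdots\oplus\mathfrak{gl}(n_r,\mathbb C)$ (block diagonal) and $\mathfrak u$ the strictly block upper triangular matrices. (Only the sequence matters for this statement.) Signed tableaux. A Young diagram is a left-justified arrangement of boxes with weakly decreasing row lengths. A $(p,q)$-signed tableau is an equivalence class of Young diagrams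 filled with $p$ pluses and $q$ minuses so that signs alternate across each row, modulo interchanging rows of equal length. Signed tableau $S_\pm$ attached to $\mathfrak q$. It is built inductively. $S^1_\pm$ is a single column containing $p_1$ pluses and $q_1$ minuses. Given $S_\pm^{i-1}$, form $S_\pm^i$ by adding $p_i$ pluses and $q_i$ minuses: go through the rows from top to bottom; to each row-end add at most one sign, namely the sign opposite to the last sign of the row if one of the new signs of that type is still available, and otherwise skip the row; when all rows have been treated, each leftover sign starts a new row of length one. One chooses the representative of $S_\pm^{i-1}$ (i.e. the order of its rows of equal length) so that the resulting rows have weakly decreasing length. The result $S_\pm=S_\pm^r$ is, as a signed tableau, independent of choices. Skew columns and the $\mathfrak q$-consistent partition. A skew diagram is obtained by removing a smaller Young diagram from a larger one containing it; a skew column is a skew diagram with at most one box per row. Let $S$ be the Young diagram underlying $S_\pm$, and $S^i$ the one underlying $S^i_\pm$ ($S^0=\emptyset$). The $\mathfrak q$-consistent partition is $S=\coprod_{i=1}^r S_i$ with $S_i=S^i\setminus S^{i-1}$, the boxes added at step $i$; each $S_i$ is a skew column with $n_i$ boxes. Overlap. For adjacent skew columns $C=S_i$, $D=S_{i+1}$, label the boxes from top to bottom as $c_1,\dots,c_k$ and $d_1,\dots,d_l$. For $1\leqslant m\leqslant\min\{k,l\}$, condition-$m$ says: $c_{k-m+t}$ is strictly left of $d_t$ in $S$ (i.e. lies in a column of smaller index) for all $1\leqslant t\leqslant m$. Then $\operatorname{overlap}(C,D)$ is the largest $m\leqslant\min\{k,l\}$ for which condition-$m$ holds, and is $0$ if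 condition-$m$ never holds. *)

(* Defs.v *)
From mathcomp Require Import all_boot.

Set Implicit Arguments.
Unset Strict Implicit.
Unset Printing Implicit Defensive.

(* A sign is a boolean, [true] for a plus and [false] for a minus.  A filling
   lists its rows from top to bottom, each row being read from left to right. *)
Definition sign := bool.
Definition filling := seq (seq sign).

Definition young_shape (sh : seq nat) : bool :=
  sorted geq sh && all (leq 1) sh.

(* [T] represents a (p,q)-signed tableau. *)
Definition signed_tableau (p q : nat) (T : filling) : bool :=
  [&& young_shape (shape T),
      all (sorted (fun a b : sign => a != b)) T,
      count_mem true (flatten T) == p &
      count_mem false (flatten T) == q].

(* Two fillings of Young diagrams with the same multiset of rows differ exactly
   by an interchange of rows of equal length. *)
Definition same_signed_tableau (T T' : filling) : bool :=
  [&& young_shape (shape T), young_shape (shape T') & perm_eq T T'].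

(* The rows of the filling are never empty, so the default value of [last] is
   irrelevant. *)
Fixpoint add_signs (p q : nat) (T : filling) : filling :=
  match T with
  | [::] => nseq p [:: true] ++ nseq q [:: false]
  | row :: T' =>
      if last true row then
        if q is q'.+1 then rcons row false :: add_signs p q' T'
        else row :: add_signs p q T'
      else
        if p is p'.+1 then rcons row true :: add_signs p' q T'
        else row :: add_signs p q T'
  end.

(* [T'] is a possible outcome of one step of the construction from [T]: [T0] is
   the chosen representative of the signed tableau of [T]. *)
Definition add_step (p q : nat) (T T' : filling) : Prop :=
  exists T0 : filling,
    [/\ same_signed_tableau T T0, T' = add_signs p q T0
      & young_shape (shape T')].

(* The k-th entries p_k and q_k of the sequence, for 1 <= k <= size s. *)
Definition pluses (s : seq (nat * nat)) (k : nat) : nat :=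
  (nth (0, 0) s k.-1).1.
Definition minuses (s : seq (nat * nat)) (k : nat) : nat :=
  (nth (0, 0) s k.-1).2.

(* [T k], for k <= size s, represents the signed tableau obtained after k steps,
   for some admissible choice of representatives; [T (size s)] represents the
   signed tableau attached to the parabolic of [s]. *)
Definition tableau_construction (s : seq (nat * nat)) (T : nat -> filling) :
    Prop :=
  T 0 = [::] /\
  forall k, 1 <= k <= size s ->
    add_step (pluses s k) (minuses s k) (T k.-1) (T k).

(* (row index, column index), both counted from 0 *)
Definition box := (nat * nat)%type.

(* The boxes of the diagram with row lengths [sh], listed row by row from top
   to bottom. *)
Definition young_boxes (sh : seq nat) : seq box :=
  [seq (a, b) | a <- iota 0 (size sh), b <- iota 0 (nth 0 sh a)].

Definition skew_boxes (sh sh' : seq nat) : seq box :=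
  [seq x <- young_boxes sh | x \notin young_boxes sh'].

(* S_k = S^k \ S^(k-1), its boxes being listed from top to bottom. *)
Definition consistent_part (T : nat -> filling) (k : nat) : seq box :=
  skew_boxes (shape (T k)) (shape (T k.-1)).

(* With lists indexed from 0, c_(k-m+t) and d_t for 1 <= t <= m are the entries
   of indices k-m+t and t for 0 <= t < m. *)
Definition overlap_condition (C D : seq box) (m : nat) : bool :=
  [forall t : 'I_m,
     (nth (0, 0) C (size C - m + t)).2 < (nth (0, 0) D t).2].

Definition overlap (C D : seq box) : nat :=
  \max_(1 <= m < (minn (size C) (size D)).+1 | overlap_condition C D m) m.

(* The remaining lemmas show that the construction can always be carried out
   and that it produces signed tableaux. *)

Lemma geq_trans : transitive geq.
Proof. by move=> y x z /= h1 h2; exact: leq_trans h2 h1. Qed.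

Lemma young_shape_cons (x : seq sign) (T : filling) :
  young_shape (shape (x :: T)) =
  [&& 0 < size x, all (fun y => size y <= size x) T & young_shape (shape T)].
Proof.
rewrite /young_shape /= (path_sortedE geq_trans) /shape all_map.
rewrite (eq_all (a2 := fun y : seq sign => size y <= size x)) //.
by case: (0 < size x); case: (all _ T); case: (sorted _ _); case: (all _ _).
Qed.

Lemma add_signs_bound (p q : nat) (T : filling) (n : nat) :
  0 < n -> all (fun y => size y <= n) T ->
  all (fun y => size y <= n.+1) (add_signs p q T).
Proof.
move=> n0; elim: T p q => [|x T IH] p q /=.
  by move=> _; rewrite all_cat !all_nseq /= !orbT.
case/andP=> hx /IH h; have hx' := leqW hx.
case: (last true x); [case: q => [|q]|case: p => [|p]];
  by rewrite /= ?size_rcons ?ltnS ?hx ?hx' h.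
Qed.

(* With p pluses and q minuses left, the row [x] is skipped. *)
Definition unavailable (p q : nat) (x : seq sign) : bool :=
  (if last true x then q else p) == 0.

Lemma unavailable_add (p q : nat) (x : seq sign) (T : filling) :
  unavailable p q x ->
  add_signs p q (x :: T) = x :: add_signs p q T.
Proof. by rewrite /unavailable /=; case: (last true x) => /eqP ->. Qed.

Lemma available_add (p q : nat) (x : seq sign) (T : filling) :
  ~~ unavailable p q x ->
  exists p' q', (forall U, add_signs p q (x :: U) =
     rcons x (~~ last true x) :: add_signs p' q' U)
   /\ (forall y, unavailable p q y -> unavailable p' q' y).
Proof.
rewrite /unavailable /=; case: (last true x).
  case: q => // q _; exists p, q; split=> // y; by case: (last true y).
case: p => // p _; exists p, q; split=> // y; by case: (last true y).
Qed.

Lemma nil_young p q : young_shape (shape (add_signs p q [::])).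
Proof.
rewrite /= /young_shape /shape map_cat !map_nseq /= -nseqD all_nseq orbT andbT.
by elim: (p + q) => // n; case: n.
Qed.

Lemma insert_unavailable (p q : nat) (x : seq sign) (T : filling) :
  0 < size x -> unavailable p q x ->
  all (fun y => size y <= size x) T -> young_shape (shape T) ->
  young_shape (shape (add_signs p q T)) ->
  exists T0, [/\ perm_eq (x :: T) T0, young_shape (shape T0)
               & young_shape (shape (add_signs p q T0))].
Proof.
move=> x0; elim: T p q => [|y T IH] p q ux.
  move=> _ _ h; exists [:: x]; split=> //; first by rewrite young_shape_cons x0.
  rewrite unavailable_add // young_shape_cons x0 h andbT /=.
  by rewrite all_cat !all_nseq /= x0 !orbT.
move=> hall hT hadd; have /andP[yx Tx] := hall.
have hyT := hT; rewrite young_shape_cons in hyT; case/and3P: hyT => y0 Ty yT.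
have [/andP[/eqP exy ay]|no] := boolP ((size y == size x) && ~~ unavailable p q y).
  have [p' [q' [E U]]] := available_add T ay.
  rewrite E young_shape_cons in hadd; case/and3P: hadd => _ _ hadd.
  have [T0 [P1 P2 P3]] := IH p' q' (U _ ux) Tx yT hadd.
  have T0x : all (fun z => size z <= size x) T0.
    by rewrite -(perm_all _ P1) /= leqnn.
  exists (y :: T0); split.
  - by rewrite -(perm_cons y) in P1; apply: perm_trans P1; rewrite (perm_catCA [:: x] [:: y]).
  - by rewrite young_shape_cons y0 P2 exy T0x.
  - by rewrite E young_shape_cons size_rcons P3 exy add_signs_bound.
exists [:: x, y & T]; split=> //; first by rewrite young_shape_cons x0 hall.
rewrite unavailable_add // young_shape_cons x0 hadd andbT /=.
have [uy|ay] := boolP (unavailable p q y).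
  rewrite -[if _ then _ else _]/(add_signs p q (y :: T)) in hadd *.
  rewrite unavailable_add //= yx /=.
  move: hadd; rewrite unavailable_add // young_shape_cons => /and3P[_ h _].
  by apply: sub_all h => z /leq_trans; apply.
have lyx : size y < size x by move: no; rewrite ay andbT ltn_neqAle yx => ->.
have [p' [q' [E _]]] := available_add T ay.
rewrite -[if _ then _ else _]/(add_signs p q (y :: T)) E /= size_rcons lyx /=.
have := add_signs_bound p' q' y0 Ty.
by apply: sub_all => z /leq_trans; apply.
Qed.

Lemma add_step_exists p q T : young_shape (shape T) ->
  exists T', add_step p q T T'.
Proof.
move=> yT; suff [T0 [h1 h2 h3]] : exists T0, [/\ perm_eq T T0,
    young_shape (shape T0) & young_shape (shape (add_signs p q T0))].
  by exists (add_signs p q T0), T0; rewrite /same_signed_tableau yT h1 h2.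
elim: T p q yT => [|x T IH] p q.
  by exists [::]; split=> //; exact: nil_young.
rewrite young_shape_cons => /and3P[x0 Tx yT].
have [ux|ax] := boolP (unavailable p q x).
  have [T0 [h1 h2 h3]] := IH p q yT.
  rewrite (perm_all _ h1) in Tx.
  have [T1 [g1 g2 g3]] := insert_unavailable x0 ux Tx h2 h3.
  by exists T1; split=> //; apply: perm_trans g1; rewrite perm_cons.
have [p' [q' [E _]]] := available_add T ax.
have [T0 [h1 h2 h3]] := IH p' q' yT.
rewrite (perm_all _ h1) in Tx.
exists (x :: T0); split; first by rewrite perm_cons.
  by rewrite young_shape_cons x0 Tx.
by rewrite E young_shape_cons size_rcons h3 add_signs_bound.
Qed.

Lemma add_signs_alternating (p q : nat) (T : filling) :
  all (sorted (fun a b : sign => a != b)) T ->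
  all (sorted (fun a b : sign => a != b)) (add_signs p q T).
Proof.
elim: T p q => [|x T IH] p q /=; first by rewrite all_cat !all_nseq /= !orbT.
case/andP=> hx /IH h.
have hr b : last true x != b -> sorted (fun a b : sign => a != b) (rcons x b).
  by case: x hx => //= a x hx hb; rewrite rcons_path hx.
by move: hr; case: (last true x) => hr;
  [case: q => [|q]|case: p => [|p]]; rewrite /= h ?hx ?hr.
Qed.

Lemma add_signs_count (p q : nat) (T : filling) (b : sign) :
  count_mem b (flatten (add_signs p q T)) =
  count_mem b (flatten T) + (if b then p else q).
Proof.
elim: T p q => [|x T IH] p q /=.
  rewrite flatten_cat count_cat.
  have E n c : count_mem b (flatten (nseq n [:: c])) = (c == b) * n.
    by elim: n => [|n IHn] /=; rewrite ?muln0 // IHn mulnS.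
  by rewrite !E; case: b E => _; rewrite ?mul1n ?mul0n ?addn0.
by case: (last true x); [case: q => [|q]|case: p => [|p]];
  rewrite /= !count_cat IH -?cats1 ?count_cat /=; case: b {IH} => /=;
  rewrite ?addn0 ?addn1 ?add0n ?addSn ?addnS ?addnA.
Qed.

Lemma add_step_signed_tableau p q p' q' T T' : signed_tableau p q T ->
  add_step p' q' T T' -> signed_tableau (p + p') (q + q') T'.
Proof.
case/and4P=> _ alt /eqP hp /eqP hq [T0 [/and3P[_ _ P] -> y]].
apply/and4P; split=> //.
- by apply: add_signs_alternating; rewrite -(perm_all _ P).
- by rewrite add_signs_count -hp -(permP (perm_flatten P)).
- by rewrite add_signs_count -hq -(permP (perm_flatten P)).
Qed.

Lemma tableau_construction_signed_tableau s T : tableau_construction s T ->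
  forall k, k <= size s ->
  signed_tableau (\sum_(1 <= j < k.+1) pluses s j)
                 (\sum_(1 <= j < k.+1) minuses s j) (T k).
Proof.
case=> T0 hT; elim=> [|k IH] hk; first by rewrite T0 !big_geq.
rewrite !(big_nat_recr k.+1) //=.
exact: add_step_signed_tableau (IH (ltnW hk)) (hT k.+1 _).
Qed.

Lemma tableau_construction_exists s : exists T, tableau_construction s T.
Proof.
elim/last_ind: s => [|s [p q] [T hT]].
  by exists (fun=> [::]); split=> // -[].
have /and4P[yT _ _ _] := tableau_construction_signed_tableau hT (leqnn _).
have [T' hT'] := add_step_exists p q yT.
exists (fun k => if k <= size s then T k else T').
case: hT => T0 hT; split=> // -[|k] //=; rewrite size_rcons /= ltnS => hk.
rewrite /pluses /minuses /= nth_rcons hk.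
have [lk|gk] := ltnP k (size s); first exact: (hT k.+1).
have -> : k = size s by apply/eqP; rewrite eqn_leq hk gk.
by rewrite eqxx.
Qed.

(* Main.v *)
Require Import Defs.
From mathcomp Require Import all_boot.
From mathcomp Require Import zify.

(** Only the columns of the boxes matter for the overlap.  For two skew columns
    [C] and [D], read from top to bottom, the columns decrease weakly, and
    condition-[m] says that the [m] leftmost boxes of [C] can be matched with
    the [m] rightmost boxes of [D], each to the left of its partner.  As for
    Hall's theorem, this is a counting condition: for every [v], the number of
    boxes of [C] in columns [< v] plus the number of boxes of [D] in columns
    [> v] is at least [m] ([overlap_conditionP]).  So the overlap is the minimum
    of these sums over [v] and of the sizes of [C] and [D].

    The sums are computed sign by sign.  Let [ends s v T] be the number of rows
    of [T] of length [> v] that end in the sign [s].  Since long rows are served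
    first, a step that adds [n] signs [s] to [T] puts exactly
    [min n (ends (~~ s) v T)] of them in columns [> v] ([count_added_gt]).
    Hence, if [n], [n~] are the numbers of signs [s], [~~ s] added at step [i],
    and [c] of the former lie in columns [< v], then
    [ends s v (T i) = (n - c) + (ends s v (T (i-1)) - n~)] with truncated
    subtraction ([ends_add_signs]): the rows just lengthened by [s], and the
    rows ending in [s] that step [i] left alone.  If step [i+1] adds [n']
    signs [~~ s], then the part of the sum coming from the boxes [s] of [S_i]
    and [~~ s] of [S_(i+1)] is [c + min n' (ends s v (T i))], which is at least
    [min n n'].  Adding over the two signs bounds the overlap from below.

    For the upper bound, the claimed value is the size of [S_i] or of [S_(i+1)],
    unless for some [s] step [i+1] adds more signs [~~ s] than step [i] adds
    signs [s], and fewer signs [s] than step [i] adds signs [~~ s]. In that case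
    one takes the least [v] with [ends s v (T (i-1)) <= n~]. By minimality all
    the signs [~~ s] of step [i] lie in columns [>= v], and the rows ending in
    [s] of length [> v] all come from step [i], so the sum for this [v] is at
    most the claimed value. *)

(** * Overlap as a counting condition *)

(** The default value 0 makes this hold past the end of the sequence too. *)
Lemma ltn_nth_sorted (cs : seq nat) (v j : nat) : sorted geq cs ->
  (v < nth 0 cs j) = (j < count (fun x => v < x) cs).
Proof.
elim: cs j => [|x cs IH] j; first by rewrite nth_nil !ltn0.
move=> /= sxs; have := sxs; rewrite (path_sortedE geq_trans) => /andP[hx _].
have [vx|xv] := ltnP v x.
  by case: j => [|j] /=; rewrite ?vx // IH ?(path_sorted sxs).
have -> : count (fun x => v < x) cs = 0.
  rewrite -[RHS](count_pred0 cs); apply: eq_in_count => y /(allP hx) /= yx.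
  by rewrite ltnNge (leq_trans yx xv).
case: j => [|j] /=; first by rewrite ltnNge xv.
rewrite add0n ltn0; apply/negbTE; rewrite -leqNgt.
have [js|js] := ltnP j (size cs); last by rewrite nth_default.
by have /= := allP hx _ (mem_nth 0 js); lia.
Qed.

Definition left_of (v : nat) (C : seq box) : nat := count (fun c => c.2 < v) C.
Definition right_of (v : nat) (C : seq box) : nat := count (fun c => v < c.2) C.

Definition columns_decrease (C : seq box) : bool := sorted geq (map snd C).

Lemma ltn_nth_column (C : seq box) (v j : nat) : columns_decrease C ->
  (v < (nth (0, 0) C j).2) = (j < right_of v C).
Proof.
move=> sC; have -> : (nth (0, 0) C j).2 = nth 0 (map snd C) j.
  have [js|js] := ltnP j (size C); first by rewrite (nth_map (0, 0)).
  by rewrite !nth_default ?size_map.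
by rewrite ltn_nth_sorted // count_map.
Qed.

Lemma left_ofS (v : nat) (C : seq box) :
  left_of v.+1 C + right_of v C = size C.
Proof.
rewrite -(count_predC (fun c : box => v < c.2)) addnC; congr (_ + _).
by apply: eq_count => c /=; rewrite -leqNgt.
Qed.

Lemma left_of0 (C : seq box) : left_of 0 C = 0.
Proof. by rewrite -[RHS](count_pred0 C). Qed.

(** If a box of [C] is not left of its partner in [D], the column [v] of the
    partner violates the inequality; conversely, if the inequality fails for
    [v], then the lowest box of [C] in a column [>= v] is matched with a box of
    [D] in a column [<= v]. *)
Lemma overlap_conditionP (C D : seq box) (m : nat) :
  columns_decrease C -> columns_decrease D -> m <= size C ->
  reflect (forall v, m <= left_of v C + right_of v D) (overlap_condition C D m).
Proof.
move=> sC sD mC; apply: (iffP forallP) => [h v|h t].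
  rewrite leqNgt; apply/negP => hv.
  have am : left_of v C < m by apply: leq_ltn_trans hv; exact: leq_addr.
  pose t := m - (left_of v C).+1; have tm : t < m by rewrite /t; lia.
  have := h (Ordinal tm) => /= hCD.
  have : v < (nth (0, 0) D t).2.
    apply: leq_ltn_trans hCD.
    case: v @t hv am tm => // v t hv am tm.
    by rewrite ltn_nth_column //; have := left_ofS v C; rewrite /t; lia.
  by rewrite ltn_nth_column // /t; lia.
rewrite ltnNge; apply/negP => hDC; have tm := ltn_ord t.
move: (erefl ((nth (0, 0) D t).2)); move: {-2}(nth (0, 0) D t).2 => v hv.
have := ltn_nth_column D v t sD; rewrite -hv ltnn => /esym/negbT.
have := h v; case: v hv => [|v] hv; first by rewrite left_of0; lia.
move: hDC; rewrite -hv ltn_nth_column //; have := left_ofS v C; lia.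
Qed.

Lemma overlap_eq (C D : seq box) (m : nat) :
  columns_decrease C -> columns_decrease D ->
  m <= size C -> m <= size D ->
  (forall v, m <= left_of v C + right_of v D) ->
  [\/ size C <= m, size D <= m | exists v, left_of v C + right_of v D <= m] ->
  overlap C D = m.
Proof.
move=> sC sD mC mD lo up; apply/eqP; rewrite eqn_leq; apply/andP; split.
  rewrite /overlap; apply/bigmax_leqP_seq => k; rewrite mem_index_iota ltnS.
  rewrite (leq_min k).
  move=> /and3P[_ kC kD] /overlap_conditionP h.
  have := h sC sD kC; case: up => [?|?|[v hv]] hk; try lia.
  exact: leq_trans (hk v) hv.
case: m mC mD lo {up} => // m mC mD lo; rewrite /overlap.
apply: (leq_bigmax_seq (F := id)).
  by rewrite mem_index_iota /= ltnS leq_min mC mD.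
exact/overlap_conditionP.
Qed.

(** * The boxes added in one step *)

(** The signs that [add_signs p q T] adds, with their columns, from top to
    bottom. *)
Fixpoint added (p q : nat) (T : filling) : seq (sign * nat) :=
  match T with
  | [::] => nseq p (true, 0) ++ nseq q (false, 0)
  | row :: T' =>
      if last true row then
        if q is q'.+1 then (false, size row) :: added p q' T' else added p q T'
      else
        if p is p'.+1 then (true, size row) :: added p' q T' else added p q T'
  end.

Lemma mem_young_boxes (sh : seq nat) (a b : nat) :
  ((a, b) \in young_boxes sh) = (b < nth 0 sh a).
Proof.
apply/allpairsPdep/idP => [[a' [b' [_]]]|h].
  by rewrite mem_iota => /andP[_ ?] [-> ->].
exists a, b; split=> //; rewrite mem_iota //=.
by rewrite add0n ltnNge; apply: contraL h => ?; rewrite nth_default.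
Qed.

Lemma filter_iota_geq (k n : nat) :
  [seq b <- iota 0 n | k <= b] = iota k (n - k).
Proof.
have [kn|nk] := leqP k n.
  rewrite -{1}(subnKC kn) iotaD add0n filter_cat.
  rewrite (eq_in_filter (a2 := pred0)) ?filter_pred0.
    rewrite (eq_in_filter (a2 := predT)) ?filter_predT // => b.
    by rewrite mem_iota => /andP[].
  by move=> b; rewrite mem_iota => /andP[_ ?] /=; lia.
have -> : n - k = 0 by lia.
rewrite (eq_in_filter (a2 := pred0)) ?filter_pred0 // => b.
by rewrite mem_iota => /andP[_ ?] /=; lia.
Qed.

Lemma columns_skew_boxes (sh sh' : seq nat) :
  map snd (skew_boxes sh sh') =
  flatten [seq iota (nth 0 sh' a) (nth 0 sh a - nth 0 sh' a)
          | a <- iota 0 (size sh)].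
Proof.
rewrite /skew_boxes /young_boxes filter_flatten map_flatten -!map_comp.
congr flatten; apply: eq_map => a /=.
rewrite filter_map -map_comp -filter_iota_geq.
rewrite (eq_map (g := id)) ?map_id; last by [].
by apply: eq_filter => b /=; rewrite mem_young_boxes -leqNgt.
Qed.

Lemma columns_skew_boxes_cons (n n' : nat) (sh sh' : seq nat) :
  map snd (skew_boxes (n :: sh) (n' :: sh')) =
  iota n' (n - n') ++ map snd (skew_boxes sh sh').
Proof.
rewrite !columns_skew_boxes /=; congr (_ ++ flatten _).
by rewrite -[1]addn0 iotaDl -map_comp.
Qed.

Lemma columns_added (p q : nat) (T : filling) :
  map snd (skew_boxes (shape (add_signs p q T)) (shape T)) =
  map snd (added p q T).
Proof.
elim: T p q => [|row T IH] p q.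
  rewrite /= /shape !map_cat !map_nseq /= -!nseqD columns_skew_boxes size_nseq.
  rewrite (eq_in_map _ (fun=> [:: 0]) _).1.
    move: (iota 0 (p + q)) (size_iota 0 (p + q)) => l <-.
    by elim: l => //= _ l ->.
  by move=> a; rewrite mem_iota nth_nil nth_nseq => /andP[_ ->].
have E := columns_skew_boxes_cons; rewrite /shape in IH E *.
by rewrite /=; case: (last true row); [case: q => [|q]|case: p => [|p]];
  rewrite /= ?size_rcons E IH ?subnn ?subSnn.
Qed.

(** New signs go to the ends of rows of [T], or to column 0. *)
Lemma added_subseq (p q : nat) (T : filling) :
  subseq (map snd (added p q T)) (shape T ++ nseq (p + q) 0).
Proof.
elim: T p q => [|row T IH] p q.
  by rewrite /= map_cat !map_nseq /= -nseqD.
have skip p' q' : p' + q' <= p + q ->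
    subseq (map snd (added p' q' T)) (shape T ++ nseq (p + q) 0).
  move=> le; apply: subseq_trans (IH p' q') _.
  by rewrite -(subnKC le) (nseqD (p' + q')) catA prefix_subseq.
rewrite /=; case: (last true row); [case: q skip => [|q]|case: p skip => [|p]];
  move=> skip /=; rewrite ?eqxx ?skip //; try lia;
  exact: subseq_trans (skip _ _ (leqnn _)) (subseq_cons _ _).
Qed.

Lemma added_sorted (p q : nat) (T : filling) :
  sorted geq (shape T) -> sorted geq (map snd (added p q T)).
Proof.
move=> sT; apply: (subseq_sorted geq_trans (added_subseq p q T)).
have s0 n : sorted geq (nseq n 0) by elim: n => // -[].
rewrite (sorted_pairwise geq_trans) pairwise_cat -!(sorted_pairwise geq_trans).
rewrite sT s0 !andbT; apply/allrelP => x y _ /nseqP[-> _]; exact: leq0n.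
Qed.

Definition new_signs (p q : nat) (s : sign) : nat := if s then p else q.

Definition ends (s : sign) (v : nat) (T : filling) : nat :=
  count (fun row => (last true row == s) && (v < size row)) T.

Lemma count_added (s : sign) (p q : nat) (T : filling) :
  count (fun x => x.1 == s) (added p q T) = new_signs p q s.
Proof.
elim: T p q => [|row T IH] p q /=.
  by rewrite count_cat !count_nseq /=; case: s; rewrite ?mul1n ?mul0n ?addn0.
by case: (last true row); [case: q => [|q]|case: p => [|p]];
  rewrite /= IH; case: (s).
Qed.

(** Rows are served by decreasing length, so the signs [s] reach the long rows
    ending in [~~ s] before any others. *)
Lemma count_added_gt (s : sign) (v p q : nat) (T : filling) :
  sorted geq (shape T) ->
  count (fun x => (x.1 == s) && (v < x.2)) (added p q T) =
  minn (new_signs p q s) (ends (~~ s) v T).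
Proof.
elim: T p q => [|row T IH] p q.
  by rewrite /= count_cat !count_nseq /= ltn0 !andbF minn0.
move=> sT; have [vr|rv] := ltnP v (size row).
  have {}IH p q := IH p q (path_sorted sT).
  rewrite /ends /= vr andbT; rewrite /ends in IH.
  case: (last true row); [case: q => [|q]|case: p => [|p]];
    by rewrite /= IH ?vr; case: (s) => /=; lia.
have hT : all (fun n => n <= v) (shape (row :: T)).
  move: sT; rewrite /= (path_sortedE geq_trans) rv /= => /andP[+ _].
  by apply: sub_all => n /= /leq_trans; apply.
transitivity 0.
  rewrite -[RHS](count_pred0 (added p q (row :: T))).
  apply: eq_in_count => x hx.
  have /(map_f snd) /(mem_subseq (added_subseq p q (row :: T))) := hx.
  rewrite mem_cat => /orP[/(allP hT) /= | /nseqP[-> _]]; last by rewrite andbF.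
  by rewrite leqNgt => /negbTE ->; rewrite andbF.
suff -> : ends (~~ s) v (row :: T) = 0 by rewrite minn0.
rewrite -[RHS](count_pred0 (row :: T)); apply: eq_in_count => r hr.
have := allP hT _ (map_f size hr).
by rewrite leqNgt => /negbTE ->; rewrite andbF.
Qed.

(** A step creates the long rows ending in a new sign [s], and destroys those
    that receive a new sign [~~ s]. *)
Lemma ends_balance (s : sign) (v p q : nat) (T : filling) :
  ends s v (add_signs p q T)
    + count (fun x => (x.1 == ~~ s) && (v < x.2)) (added p q T) =
  ends s v T + count (fun x => (x.1 == s) && (v <= x.2)) (added p q T).
Proof.
rewrite /ends; elim: T p q => [|row T IH] p q.
  by rewrite /= !count_cat !count_nseq /=; case: s; case: v; lia.
rewrite /=; case l: (last true row).
  by case: q => [|q]; [have := IH p 0 | have := IH p q];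
    rewrite /= ?last_rcons ?size_rcons ?l; case: (s) => /=;
    rewrite ?ltnS; case: (v < size row); case: (v <= size row) => /=; lia.
by case: p => [|p]; [have := IH 0 q | have := IH p q];
  rewrite /= ?last_rcons ?size_rcons ?l; case: (s) => /=;
    rewrite ?ltnS; case: (v < size row); case: (v <= size row) => /=; lia.
Qed.

Lemma count_threshold (s : sign) (v : nat) (l : seq (sign * nat)) :
  count (fun x => (x.1 == s) && (x.2 < v)) l
    + count (fun x => (x.1 == s) && (v <= x.2)) l =
  count (fun x => x.1 == s) l.
Proof.
elim: l => //= x l.
by case: (x.1 == s); case: (ltnP x.2 v) => /= _; lia.
Qed.

Lemma ends_add_signs (s : sign) (v p q : nat) (T : filling) :
  sorted geq (shape T) ->
  count (fun x => (x.1 == s) && (x.2 < v)) (added p q T)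
    + ends s v (add_signs p q T) =
  new_signs p q s + (ends s v T - new_signs p q (~~ s)).
Proof.
move=> sT; have := ends_balance s v p q T.
rewrite count_added_gt // negbK.
have := count_threshold s v (added p q T); rewrite count_added.
by lia.
Qed.

Lemma count_by_sign (P : pred nat) (l : seq (sign * nat)) (s : sign) :
  count P (map snd l) = count (fun x => (x.1 == s) && P x.2) l
                      + count (fun x => (x.1 == ~~ s) && P x.2) l.
Proof. by elim: l => //= -[[] c] l ->; case: s => /=; lia. Qed.

Lemma size_boxes_added (V : filling) (B : seq box) (a b : nat) :
  map snd B = map snd (added a b V) -> size B = a + b.
Proof.
move=> eB; rewrite -(size_map snd) eB size_map.
rewrite -(count_predC (fun x => x.1 == true)) (count_added true).
congr (_ + _); rewrite -[RHS](count_added false a b V).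
by apply: eq_count => -[[] n].
Qed.

(** * The overlap of two successive steps *)

Section TwoSteps.

Variables (p q p' q' : nat) (T U : filling) (C D : seq box).
Hypothesis sT : sorted geq (shape T).
Hypothesis sU : sorted geq (shape U).
Hypothesis pU : perm_eq (add_signs p q T) U.
Hypothesis eC : map snd C = map snd (added p q T).
Hypothesis eD : map snd D = map snd (added p' q' U).

Let fresh_left (s : sign) (v : nat) : nat :=
  count (fun x => (x.1 == s) && (x.2 < v)) (added p q T).

Lemma ends_representative (s : sign) (v : nat) :
  ends s v U = ends s v (add_signs p q T).
Proof. by rewrite /ends (permP pU). Qed.

(** The boxes [s] of the first step are grouped with the boxes [~~ s] of the
    second one, which in columns [> v] can only extend rows ending in [s]. *)
Lemma threshold_sum (s : sign) (v : nat) :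
  left_of v C + right_of v D =
    (fresh_left s v + minn (new_signs p' q' (~~ s)) (ends s v U))
    + (fresh_left (~~ s) v + minn (new_signs p' q' s) (ends (~~ s) v U)).
Proof.
have -> : left_of v C = fresh_left s v + fresh_left (~~ s) v.
  rewrite /left_of -[count _ C](count_map snd (fun n => n < v)) eC.
  exact: count_by_sign.
have -> : right_of v D =
    minn (new_signs p' q' s) (ends (~~ s) v U)
    + minn (new_signs p' q' (~~ s)) (ends s v U).
  rewrite /right_of -[count _ D](count_map snd (fun n => v < n)) eD.
  by rewrite (count_by_sign _ _ s) !count_added_gt // negbK.
by lia.
Qed.

Lemma fresh_left_ends (s : sign) (v : nat) :
  fresh_left s v + ends s v U =
  new_signs p q s + (ends s v T - new_signs p q (~~ s)).
Proof. by rewrite ends_representative; exact: ends_add_signs. Qed.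

Lemma threshold_lower (v : nat) :
  minn p q' + minn p' q <= left_of v C + right_of v D.
Proof.
rewrite (threshold_sum true).
by have := fresh_left_ends true v; have := fresh_left_ends false v => /=; lia.
Qed.

(** At the least [v] for which the signs [~~ s] of the first step suffice for
    all rows of length [> v] ending in [s], none of these signs is left of
    column [v]: there are enough rows of length [>= v] to host all of them. *)
Lemma threshold_upper (s : sign) :
  exists v, left_of v C + right_of v D <= new_signs p q s + new_signs p' q' s.
Proof.
have ex : exists v, ends s v T <= new_signs p q (~~ s).
  exists (\max_(r <- T) size r).
  suff -> : ends s (\max_(r <- T) size r) T = 0 by [].
  rewrite -[RHS](count_pred0 T); apply: eq_in_count => r hr /=.
  by rewrite [_ < _]ltnNge (leq_bigmax_seq (F := size)) // andbF.
case: (ex_minnP ex) => v hv min_v; exists v.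
have left0 : fresh_left (~~ s) v = 0.
  case: v hv min_v => [|v] hv min_v.
    rewrite /fresh_left -[RHS](count_pred0 (added p q T)).
    by apply: eq_count => x; rewrite ltn0 andbF.
  have many : new_signs p q (~~ s) < ends s v T.
    by rewrite ltnNge; apply/negP => /min_v; rewrite ltnn.
  have := count_threshold (~~ s) v.+1 (added p q T).
  rewrite count_added (count_added_gt (~~ s) v p q T sT) negbK.
  by rewrite (minn_idPl (ltnW many)) /fresh_left; lia.
rewrite (threshold_sum s) left0; have := fresh_left_ends s v; lia.
Qed.

Lemma overlap_two_steps : overlap C D = minn p q' + minn p' q.
Proof.
have zC := size_boxes_added T C p q eC.
have zD := size_boxes_added U D p' q' eD.
apply: overlap_eq; rewrite ?zC ?zD; try lia.
- by rewrite /columns_decrease eC added_sorted.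
- by rewrite /columns_decrease eD added_sorted.
- exact: threshold_lower.
have [pq|pq] := leqP p q'; have [qp|qp] := leqP q p'.
- by apply: Or31; lia.
- by apply: Or33; have [v /= hv] := threshold_upper true; exists v; lia.
- by apply: Or33; have [v /= hv] := threshold_upper false; exists v; lia.
- by apply: Or32; lia.
Qed.

End TwoSteps.

Lemma same_shape (T T0 : filling) :
  same_signed_tableau T T0 -> sorted geq (shape T0) /\ shape T = shape T0.
Proof.
case/and3P=> /andP[s1 _] /andP[s2 _] /(perm_map size) pT; split=> //.
apply: (sorted_eq geq_trans) => // x y /=.
by rewrite andbC -eqn_leq => /eqP.
Qed.

Theorem theorem3p4 (s : seq (nat * nat)) (hs : (0, 0) \notin s)
    (T : nat -> filling) (hT : tableau_construction s T)
    (i : nat) (hi : 1 <= i <= size s - 1) :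
  overlap (consistent_part T i) (consistent_part T i.+1) =
  minn (pluses s i) (minuses s i.+1) + minn (pluses s i.+1) (minuses s i).
Proof.
case: hT => _ step; case/andP: hi => i1 ir.
have [T0 [eqT0 TiE _]] := step i ltac:(lia).
have [U [eqU TSiE _]] := step i.+1 ltac:(lia).
rewrite /= in eqU TSiE.
have [sT0 shT0] := same_shape _ _ eqT0; have [sU shU] := same_shape _ _ eqU.
apply: (@overlap_two_steps _ _ _ _ T0 U) => //.
- by rewrite -TiE; case/and3P: eqU.
- by rewrite /consistent_part shT0 TiE columns_added.
- by rewrite /consistent_part /= shU TSiE columns_added.
Qed.
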